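(* There exists a function $\varepsilon:\mathbb{Z}_{>0}\to\mathbb{R}$ with $\varepsilon(n)\to 0$ as $n\to\infty$ such that for every positive integer $n$ there exists a convex centrally symmetric (i.e. $P=-P$) $n$-dimensional polytope $P\subset\mathbb{R}^n$ with the following properties: (i) All the vertices of $P$ lie on the unit sphere $S^{n-1}\subset\mathbb{R}^n$, and each vertex belongs either to the positive coordinate orthant (all coordinates non-negative) or to the negative coordinate orthant (all coordinates non-positive). (ii) For any vertex $A$ of $P$, if $F,F'$ are facets of $P$ with $A\in F$ and $-A\in F'$, then $F\cap F'=\emptyset$. (iii) If $n\ge 2$, the number of vertices of $P$ is less than $e^{(\frac12+\varepsilon(n))\sqrt{n}\,\log n}$.
   Context: A facet of an $n$-dimensional polytope is a face of dimension $n-1$. $\log$ denotes the natural logarithm. *)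

(* Defs.v *)
From HB Require Import structures.
From mathcomp Require Import all_boot all_order all_algebra.
From mathcomp Require Import all_classical all_reals all_analysis.

Set Implicit Arguments.
Unset Strict Implicit.
Unset Printing Implicit Defensive.

Import Order.TTheory GRing.Theory Num.Theory.
Import numFieldNormedType.Exports.

Local Open Scope classical_set_scope.
Local Open Scope ring_scope.

Definition dot (R : realType) (n : nat) (x y : 'rV[R]_n) : R :=
  \sum_(i < n) x 0 i * y 0 i.

(* The library norm on row vectors is the sup norm, hence this definition. *)
Definition enorm (R : realType) (n : nat) (x : 'rV[R]_n) : R :=
  Num.sqrt (dot x x).

Definition unit_sphere (R : realType) (n : nat) : set 'rV[R]_n :=
  [set x | enorm x = 1].

Definition pos_orthant (R : realType) (n : nat) : set 'rV[R]_n :=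
  [set x | forall i, 0 <= x 0 i].

Definition neg_orthant (R : realType) (n : nat) : set 'rV[R]_n :=
  [set x | forall i, x 0 i <= 0].

Definition conv_hull (R : realType) (n : nat) (A : set 'rV[R]_n) :
  set 'rV[R]_n := smallest (@convex_set R 'rV[R]_n) A.

Definition affine_set (R : realType) (n : nat) (A : set 'rV[R]_n) : Prop :=
  forall (x y : 'rV[R]_n) (t : R), A x -> A y -> A (t *: x + (1 - t) *: y).

Definition aff_hull (R : realType) (n : nat) (A : set 'rV[R]_n) :
  set 'rV[R]_n := smallest (@affine_set R n) A.

(* The empty set has no dimension in this sense. *)
Definition has_dim (R : realType) (n : nat) (A : set 'rV[R]_n) (d : nat) :
  Prop :=
  exists (x0 : 'rV[R]_n) (V : {vspace 'rV[R]_n}),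
    \dim V = d /\ aff_hull A = [set x | x - x0 \in V].

Definition is_polytope (R : realType) (n : nat) (P : set 'rV[R]_n) : Prop :=
  exists A : set 'rV[R]_n, finite_set A /\ P = conv_hull A.

Definition centrally_symmetric (R : realType) (n : nat) (P : set 'rV[R]_n) :
  Prop := P = [set - x | x in P].

(* Taking c = 0, the empty face and P itself are faces. *)
Definition is_face (R : realType) (n : nat) (P F : set 'rV[R]_n) : Prop :=
  exists (c : 'rV[R]_n) (b : R),
    (forall x, P x -> dot c x <= b) /\ F = P `&` [set x | dot c x = b].

Definition vertices (R : realType) (n : nat) (P : set 'rV[R]_n) :
  set 'rV[R]_n := [set v | is_face P [set v]].

Definition is_facet (R : realType) (n : nat) (P F : set 'rV[R]_n) : Prop :=
  exists d : nat, [/\ has_dim P d.+1, is_face P F & has_dim F d].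

(* Main.v *)
Require Import Defs.
From mathcomp Require Import all_boot all_order all_algebra.
From mathcomp Require Import all_classical all_reals all_analysis.
From mathcomp Require Import ring lra.

(** For a set [S] of coordinates let [v_S] be the normalised indicator of [S],
and let [P] be the convex hull of the [v_S] and [- v_S], where [S] runs over a
family of nonempty sets chosen as follows.  Place the [n] coordinates in a
square grid with about [sqrt n] columns and [sqrt n] rows.  Call [S] almost
transversal if it has at most one element in every column, except possibly in
one column where it is arbitrary.  A full choice of one element per column can
be made in about [(sqrt n)^(sqrt n) = exp (sqrt n log n / 2)] ways, while the
choice of the exceptional column and of a subset of it contributes only a
factor [exp (O (sqrt n))]; this gives the bound on the number of vertices.

Put [c(S)] for the sum of the coordinates of [c] over [S].  A functional [c]
that is at most 1 on the symmetric body [P] is a vector with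
[|c(S)| <= sqrt |S|] for all [S] in the family, and it takes the value [+-1] at
[v_S] exactly when [S] is tight, i.e. [c(S) = +-sqrt |S|].  If facets through
[A] and [- A] met, their functionals would share a maximising generator [B], so
one functional would be tight with equal signs on the sets [S] and [S'] of [A]
and [B], and the other one tight with opposite signs.  One of the two is
impossible:

- if [S] and [S'] meet, opposite signs are impossible
  ([tight_not_opposite]), because the family is closed under nonempty subsets,
  and [S \ S'] and [S' \ S] are too small to account for the difference
  [c(S) - c(S')];

- if [S] and [S'] are disjoint, equal signs are impossible
  ([tight_not_disjoint]).  This is where the exceptional column serves.  The
  marginal values [sqrt (k+1) - sqrt k] decrease in [k].  Every element of a
  tight set [S'] weighs at least the marginal value below [|S'|], and an
  element that can be added to a tight set [S] weighs at most the marginal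
  value above [|S|].  So if some element of [S'] can be added to [S] within the
  family, then [|S| < |S'|].  The freedom in one column makes such an addition
  or a contradictory exchange always available, in both directions, whence
  [|S| < |S'| < |S|]. *)

Set Implicit Arguments.
Unset Strict Implicit.
Unset Printing Implicit Defensive.

Import Order.TTheory GRing.Theory Num.Theory.
Import numFieldNormedType.Exports.

Local Open Scope classical_set_scope.
Local Open Scope ring_scope.

(** * Increments of the square root *)

Section SqrtIncrements.
Context (R : realType).

Lemma sqrt_natS_sqr (k : nat) :
  Num.sqrt k.+1%:R ^+ 2 = Num.sqrt k%:R ^+ 2 + 1 :> R.
Proof. by rewrite !sqr_sqrtr ?ler0n// -natr1. Qed.

(** Strict concavity of the square root: comparing increments compares sizes, in
the reverse order. *)
Lemma sqrt_increment_le (a b : nat) :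
  Num.sqrt a.+1%:R - Num.sqrt a%:R <= Num.sqrt b.+1%:R - Num.sqrt b%:R :> R ->
  (b <= a)%N.
Proof.
move=> h; rewrite leqNgt; apply/negP => ab.
have pr : Num.sqrt a%:R < Num.sqrt b%:R :> R by rewrite ltr_sqrt ?ltr_nat ?ltr0n ?(leq_trans _ ab).
have qu : Num.sqrt a.+1%:R < Num.sqrt b.+1%:R :> R by rewrite ltr_sqrt ?ltr_nat ?ltr0n.
have := sqrt_natS_sqr a; have := sqrt_natS_sqr b.
have := @sqrtr_ge0 R a%:R; have := @sqrtr_ge0 R a.+1%:R.
have : Num.sqrt b%:R < Num.sqrt b.+1%:R :> R by rewrite ltr_sqrt ?ltr_nat ?ltr0n.
move: h pr qu.
set p := Num.sqrt a%:R; set q := Num.sqrt a.+1%:R.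
set r := Num.sqrt b%:R; set u := Num.sqrt b.+1%:R.
move=> h pr qu ru q0 p0 ub qa.
(* Both increments satisfy (q - p) * (q + p) = 1 = (u - r) * (u + r). *)
have up : 0 < (u - r) * (u + r - (q + p)) by apply: mulr_gt0; lra.
have mono : 0 <= (u - r - (q - p)) * (q + p) by apply: mulr_ge0; lra.
nra.
Qed.

Lemma sqrt_card_proper (T : finType) (A B : {set T}) :
  A \proper B -> Num.sqrt #|A|%:R < Num.sqrt #|B|%:R :> R.
Proof.
move=> /proper_card AB.
by rewrite ltr_sqrt ?ltr_nat// ltr0n (leq_ltn_trans _ AB).
Qed.

End SqrtIncrements.

(** * Almost transversal sets *)

Section AlmostTransversal.
Context (T : finType) (C : eqType) (col : T -> C).
Implicit Types (S : {set T}) (x y z : T).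

(** Two distinct elements in a common column occur only in the column of [x].
The exceptional column is named by an element [x], below taken in the set, so
that being almost transversal entails being nonempty. *)
Definition transversal_off x S : bool :=
  [forall y in S, forall z in S,
    (y != z) && (col y == col z) ==> (col y == col x)].

Definition almost_transversal S : bool := [exists x in S, transversal_off x S].

Lemma transversal_offP x S :
  reflect {in S &, forall y z, y != z -> col y = col z -> col y = col x}
          (transversal_off x S).
Proof.
apply: (iffP forall_inP) => [h y z yS zS yz cyz|h y yS].
  by have /forall_inP/(_ z zS)/implyP := h y yS; rewrite yz cyz eqxx => /(_ isT)/eqP.
apply/forall_inP => z zS; apply/implyP => /andP[yz /eqP cyz].
by apply/eqP; apply: h zS yz cyz.
Qed.

Lemma almost_transversal1 x : almost_transversal [set x]%SET.
Proof.
apply/exists_inP; exists x; rewrite ?inE//.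
by apply/transversal_offP => y z /set1P-> /set1P->.
Qed.

(** If the subset misses the exceptional column, it is a genuine transversal and
any of its elements can name the exceptional column. *)
Lemma almost_transversal_sub S S' :
  S' \subset S -> S' != finset.set0 -> almost_transversal S -> almost_transversal S'.
Proof.
move=> /fintype.subsetP sub /finset.set0Pn[x0 x0S'] /exists_inP[x xS /transversal_offP off].
have [/existsP[x' /andP[x'S' /eqP cx']]|none] := boolP [exists x', (x' \in S') && (col x' == col x)].
  apply/exists_inP; exists x' => //; apply/transversal_offP => y z yS zS yz cyz.
  by rewrite cx'; apply: off cyz => //; exact: sub.
apply/exists_inP; exists x0 => //; apply/transversal_offP => y z yS zS yz cyz.
case/existsP: none; exists y; rewrite yS; apply/eqP.
by apply: off cyz => //; exact: sub.
Qed.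

Lemma almost_transversal_add x y S :
  x \in S -> transversal_off x S ->
  col y = col x \/ {in S, forall z, col z != col y} ->
  almost_transversal (y |: S)%SET.
Proof.
move=> xS /transversal_offP off fresh.
apply/exists_inP; exists x; first by rewrite !inE xS orbT.
apply/transversal_offP => a b; rewrite !inE.
move=> /orP[/eqP->|aS] /orP[/eqP->|bS]; first by rewrite eqxx.
- by move=> _ cyb; case: fresh => // /(_ b bS); rewrite cyb eqxx.
- move=> _ cay; case: fresh => [<- //|/(_ a aS)]; by rewrite cay eqxx.
- exact: off.
Qed.

Lemma almost_transversal_exchange u x z S :
  u \in S -> transversal_off u S -> z \in S -> col x = col z -> u != z ->
  almost_transversal (x |: (S :\ z))%SET.
Proof.
move=> uS /transversal_offP off zS cxz uz.
apply/exists_inP; exists u; first by rewrite !inE uS uz orbT.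
apply/transversal_offP => a b; rewrite !inE.
move=> /orP[/eqP->|/andP[az aS]] /orP[/eqP->|/andP[bz bS]]; first by rewrite eqxx.
- by move=> _; rewrite cxz => czb; apply: off czb => //; rewrite eq_sym.
- by move=> _ cax; rewrite cxz in cax; apply: off cax.
- exact: off.
Qed.

End AlmostTransversal.

(** * Functionals that are tight on almost transversal sets *)

Section TightSets.
Context (R : realType) (T : finType) (C : eqType) (col : T -> C).
Implicit Types (S : {set T}) (c : T -> R).

Local Notation F := (almost_transversal col).

Definition mass c S : R := \sum_(i in S) c i.

(** For [v_S] the normalised indicator of [S], this says that the functional [c]
is at most 1 on every [v_S]. *)
Definition sqrt_bounded c : Prop :=
  forall S, F S -> mass c S <= Num.sqrt #|S|%:R.

Lemma massN c S : mass (fun i => - c i) S = - mass c S.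
Proof. by rewrite /mass sumrN. Qed.

Lemma mass_add c x S : x \notin S -> mass c (x |: S)%SET = c x + mass c S.
Proof. by move=> xS; rewrite /mass big_setU1. Qed.

Lemma mass_del c x S : x \in S -> mass c S = c x + mass c (S :\ x)%SET.
Proof. by move=> xS; rewrite /mass (big_setD1 x). Qed.

Lemma mass_sub c S S' : F S -> sqrt_bounded c -> S' \subset S ->
  mass c S' <= Num.sqrt #|S'|%:R.
Proof.
move=> FS cF sub; have [->|ne] := eqVneq S' finset.set0.
  by rewrite /mass big_set0 cards0 sqrtr0.
by apply: cF; exact: almost_transversal_sub FS.
Qed.

(** Splitting off the intersection gives
[c(S) - c(S') = c(S \ S') - c(S' \ S)], and the right side is at most
[sqrt |S \ S'| + sqrt |S' \ S|], which is less than [sqrt |S| + sqrt |S'|] as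
soon as the intersection is nonempty. *)
Lemma tight_not_opposite c S S' : F S -> F S' ->
  sqrt_bounded c -> sqrt_bounded (fun i => - c i) ->
  S :&: S' != finset.set0 ->
  mass c S = Num.sqrt #|S|%:R -> mass c S' = - Num.sqrt #|S'|%:R -> False.
Proof.
move=> FS FS' cF cNF /finset.set0Pn[x /finset.setIP[xS xS']] tS tS'.
have D1 : mass c (S :\: S')%SET <= Num.sqrt #|(S :\: S')%SET|%:R.
  by apply: mass_sub FS cF _; exact: finset.subsetDl.
have D2 : - mass c (S' :\: S)%SET <= Num.sqrt #|(S' :\: S)%SET|%:R.
  by rewrite -massN; apply: mass_sub FS' cNF _; exact: finset.subsetDl.
have E1 : mass c S = mass c (S :&: S')%SET + mass c (S :\: S')%SET.
  by rewrite /mass (big_setID S').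
have E2 : mass c S' = mass c (S :&: S')%SET + mass c (S' :\: S)%SET.
  by rewrite /mass (big_setID S) finset.setIC.
have P1 : (S :\: S')%SET \proper S.
  by apply/fintype.properP; split; [exact: finset.subsetDl|exists x; rewrite ?inE ?xS ?xS'].
have P2 : (S' :\: S)%SET \proper S'.
  by apply/fintype.properP; split; [exact: finset.subsetDl|exists x; rewrite ?inE ?xS ?xS'].
have := sqrt_card_proper R P1; have := sqrt_card_proper R P2.
by lra.
Qed.

Lemma tight_add c x S : sqrt_bounded c -> mass c S = Num.sqrt #|S|%:R ->
  x \notin S -> F (x |: S)%SET ->
  c x <= Num.sqrt #|S|.+1%:R - Num.sqrt #|S|%:R.
Proof.
move=> cF tS xS /cF; rewrite mass_add// tS cardsU1 xS add1n.
by lra.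
Qed.

Lemma tight_del c x S : sqrt_bounded c -> F S -> mass c S = Num.sqrt #|S|%:R ->
  x \in S ->
  Num.sqrt #|(S :\ x)%SET|.+1%:R - Num.sqrt #|(S :\ x)%SET|%:R <= c x.
Proof.
move=> cF FS tS xS.
have := mass_sub FS cF (finset.subsetDl S [set x]%SET).
have : #|S| = #|(S :\ x)%SET|.+1 by rewrite (cardsD1 x) xS.
by move: tS; rewrite (mass_del _ xS) => + <-; lra.
Qed.

(** Let [x] name the exceptional column of [S'].  If [x] can be added to [S],
comparing marginal values gives the claim.  Otherwise the column of [x] is not
the exceptional one of [S] and holds exactly one element [z] of [S].  Then [z]
may be added to [S'], in its exceptional column, and [x] may replace [z] in [S].
The exchange gives [c x <= c z], while [x] is worth the marginal value below
[|S'|] and [z] at most the strictly smaller one above [|S'|]. *)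
Lemma tight_disjoint_card c S S' : F S -> F S' -> sqrt_bounded c ->
  S :&: S' = finset.set0 ->
  mass c S = Num.sqrt #|S|%:R -> mass c S' = Num.sqrt #|S'|%:R ->
  (#|S| < #|S'|)%N.
Proof.
move=> FS FS' cF dis tS tS'.
have [u uS offu] := exists_inP FS; have [x xS' offx] := exists_inP FS'.
have notin y : y \in S -> y \notin S'.
  by move=> yS; apply/negP => yS'; have := finset.in_set0 y; rewrite -dis inE yS yS'.
have xS : x \notin S by apply: contraL xS' => /notin.
have lower := tight_del cF FS' tS' xS'.
have [FSx|nFSx] := boolP (F (x |: S)%SET).
  have /sqrt_increment_le := le_trans lower (tight_add cF tS xS FSx).
  by rewrite (cardsD1 x S') xS' add1n ltnS.
have xu : col x != col u.
  by apply: contraNneq nFSx => xu; apply: almost_transversal_add uS offu _; left.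
have [/existsP[z /andP[zS /eqP czx]]|fresh] :=
    boolP [exists z, (z \in S) && (col z == col x)]; last first.
  case/negP: nFSx; apply: almost_transversal_add uS offu _; right => z zS.
  by apply: contraNneq fresh => czx; apply/existsP; exists z; rewrite zS czx eqxx.
have uz : u != z by apply: contraNneq xu => ->; rewrite czx.
have FS'z : F (z |: S')%SET by apply: almost_transversal_add xS' offx _; left.
have FSxz := almost_transversal_exchange uS offu zS (esym czx) uz.
have cz := tight_add cF tS' (notin z zS) FS'z.
have cxz : c x <= c z.
  have := cF _ FSxz; rewrite mass_add ?inE ?(negPf xS) ?andbF//.
  have -> : #|(x |: S :\ z)%SET| = #|S|.
    by rewrite cardsU1 !inE (negPf xS) andbF (cardsD1 z S) zS.
  by rewrite -tS (mass_del _ zS); lra.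
have /sqrt_increment_le := le_trans lower (le_trans cxz cz).
by rewrite (cardsD1 x S') xS' add1n ltnn.
Qed.

Lemma tight_not_disjoint c S S' : F S -> F S' -> sqrt_bounded c ->
  S :&: S' = finset.set0 ->
  mass c S = Num.sqrt #|S|%:R -> mass c S' = Num.sqrt #|S'|%:R -> False.
Proof.
move=> FS FS' cF dis tS tS'.
have := tight_disjoint_card FS FS' cF dis tS tS'.
rewrite finset.setIC in dis.
by rewrite ltnNge ltnW ?(tight_disjoint_card FS' FS cF).
Qed.

End TightSets.

(** * Counting almost transversal sets *)

Section Counting.
Context (T C K : finType) (col : T -> C) (row : T -> K).
Hypothesis grid_inj : forall x y, col x = col y -> row x = row y -> x = y.

(** The code of a set: its exceptional column, the rows it occupies there, and
the row, if any, that it occupies in each of the other columns. *)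
Definition decode (p : C * {set K} * {ffun C -> option K}) : {set T} :=
  [set x | if col x == p.1.1 then row x \in p.1.2
           else p.2 (col x) == Some (row x)]%SET.

Lemma almost_transversal_decode S : almost_transversal col S ->
  exists p, S = decode p.
Proof.
move=> /exists_inP[u uS /transversal_offP off].
exists (col u, row @: [set x in S | col x == col u]%SET,
  [ffun k => omap row [pick x in S | col x == k]]).
apply/finset.setP => x; rewrite inE /=; case: eqP => cxu.
  apply/idP/imsetP => [xS|[y]]; first by exists x; rewrite ?inE ?xS ?cxu ?eqxx.
  by rewrite inE => /andP[yS /eqP cyu] /grid_inj ->; rewrite // cyu.
rewrite ffunE; case: pickP => [y /andP[yS /eqP cyx]|none] /=.
  apply/idP/eqP => [xS|[ryx]]; last by rewrite -(grid_inj cyx ryx).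
  have [->//|yx] := eqVneq y x.
  by case: cxu; rewrite -cyx; apply: off yx cyx.
by have := none x; rewrite /= eqxx andbT => ->.
Qed.

Lemma card_almost_transversal :
  (#|[set S | almost_transversal col S]%SET| <= #|C| * 2 ^ #|K| * #|K|.+1 ^ #|C|)%N.
Proof.
have sub : [set S | almost_transversal col S]%SET \subset decode @: finset.setT.
  apply/fintype.subsetP => S; rewrite inE => /almost_transversal_decode[p ->].
  exact: imset_f.
apply: leq_trans (subset_leq_card sub) _.
apply: leq_trans (leq_imset_card _ _) _.
have card_sets : #|{: {set K}}| = (2 ^ #|K|)%N.
  by rewrite -[in RHS]cardsT -finset.card_powerset finset.powersetT cardsT.
by rewrite cardsT !card_prod card_ffun card_option card_sets.
Qed.

End Counting.

(** * Faces of convex hulls *)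

Section Polytopes.
Context (R : realType) (n : nat).
Implicit Types (x y c : 'rV[R]_n) (A P F : set 'rV[R]_n).

Lemma dotDr c x y : dot c (x + y) = dot c x + dot c y.
Proof. by rewrite /dot -big_split; apply: eq_bigr => i _; rewrite mxE mulrDr. Qed.

Lemma dotZr c t x : dot c (t *: x) = t * dot c x.
Proof. by rewrite /dot mulr_sumr; apply: eq_bigr => i _; rewrite mxE mulrCA. Qed.

Lemma dotC x y : dot x y = dot y x.
Proof. by apply: eq_bigr => i _; rewrite mulrC. Qed.

Lemma dotDl c d x : dot (c + d) x = dot c x + dot d x.
Proof. by rewrite !(dotC _ x) dotDr. Qed.

Lemma dotZl c t x : dot (t *: c) x = t * dot c x.
Proof. by rewrite !(dotC _ x) dotZr. Qed.

Lemma dotNr c x : dot c (- x) = - dot c x.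
Proof. by rewrite -scaleN1r dotZr mulN1r. Qed.

Lemma convex_lmod_setP A :
  (forall x y (t : R), 0 < t -> t < 1 -> A x -> A y ->
    A (t *: x + (1 - t) *: y)) ->
  @convex_set R 'rV[R]_n A.
Proof.
move=> h; apply/convex_setW => x y xA yA t t0 t1.
by apply/mem_set; apply: h => //; exact: set_mem.
Qed.

Lemma sub_conv_hull A : A `<=` conv_hull A.
Proof. exact: sub_gen_smallest. Qed.

Lemma conv_hull_lt A c b : (forall a, A a -> dot c a < b) ->
  forall x, conv_hull A x -> dot c x < b.
Proof.
move=> hA; apply: smallest_sub => //.
apply: convex_lmod_setP => x y t t0 t1 /= xb yb.
by rewrite dotDr !dotZr; nra.
Qed.

(** Otherwise the generators, and with them the whole hull, would lie in the open
half-space, which is convex. *)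
Lemma conv_hull_max_attained A c b x :
  (forall y, conv_hull A y -> dot c y <= b) ->
  conv_hull A x -> dot c x = b -> exists2 a, A a & dot c a = b.
Proof.
move=> max xP xb; apply: contrapT => none.
suff : dot c x < b by rewrite xb ltxx.
apply: (conv_hull_lt _ xP) => a aA; rewrite lt_neqAle max ?andbT//; last first.
  exact: sub_conv_hull.
by apply/eqP => ab; apply: none; exists a.
Qed.

Lemma vertices_conv_hull A : vertices (conv_hull A) `<=` A.
Proof.
move=> v [c [b [max /seteqP[/(_ v erefl)[vP vb] sub]]]].
have [a aA ab] := conv_hull_max_attained max vP vb.
by have <- : a = v by apply: sub; split => //; exact: sub_conv_hull.
Qed.

Lemma conv_hull_symmetric A : (forall x, A x -> A (- x)) ->
  centrally_symmetric (conv_hull A).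
Proof.
move=> AN.
have sub : conv_hull A `<=` [set - x | x in conv_hull A].
  apply: smallest_sub; last first.
    by move=> x /AN xA; exists (- x); rewrite ?opprK//; exact: sub_conv_hull.
  move=> x y t /set_mem[x' x'P <-] /set_mem[y' y'P <-]; apply/mem_set.
  exists (conv t (x' : convex_lmodType _) (y' : convex_lmodType _)); last first.
    by rewrite /conv/= opprD -!scalerN.
  move=> B [cB AB]; apply/set_mem.
  have BP z : conv_hull A z -> z \in B by move=> zP; apply/mem_set; exact: (zP B (conj cB AB)).
  exact: cB (BP _ x'P) (BP _ y'P).
apply/seteqP; split => // _ [x /sub[y yP <-] <-].
by rewrite opprK.
Qed.

Lemma has_dim_uniq P d e : has_dim P d -> has_dim P e -> d = e.
Proof.
move=> [x [V [<- hV]]] [y [W [<- hW]]]; congr (\dim _).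
have E : [set z | z - x \in V] = [set z | z - y \in W] by rewrite -hV.
have xyW : x - y \in W.
  suff : [set z | z - x \in V] x by rewrite E.
  by rewrite /= subrr mem0v.
apply/vspaceP => u.
have : [set z | z - x \in V] (u + x) = [set z | z - y \in W] (u + x) by rewrite E.
rewrite /= addrK -addrA => /(congr1 asbool); rewrite !asboolb => ->.
by rewrite rpredDr.
Qed.

Lemma has_dim_full A : (0 < n)%N ->
  (forall i, A (delta_mx 0 i)) -> (forall i, A (- delta_mx 0 i)) ->
  has_dim (conv_hull A) n.
Proof.
move=> n0 Ae ANe; exists 0, fullv; split.
  by rewrite dimvf /dim /= mul1n.
apply/seteqP; split => x; rewrite /= ?memvf// => _ M [affM PM].
have MA a : A a -> M a by move=> /sub_conv_hull/PM.
have M0 : M 0.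
  have := affM _ _ 2^-1 (MA _ (Ae (Ordinal n0))) (MA _ (ANe (Ordinal n0))).
  rewrite scalerN -scalerBl; have -> : 2^-1 - (1 - 2^-1) = 0 :> R by lra.
  by rewrite scale0r.
have MZ t y : M y -> M (t *: y).
  by move=> /(affM _ _ t)/(_ M0); rewrite scaler0 addr0.
(* The sum is twice the midpoint, which needs only affine combinations with 0. *)
have MD y z : M y -> M z -> M (y + z).
  move=> My Mz; have := MZ 2 _ (affM _ _ 2^-1 My Mz).
  congr (M _); rewrite scalerDr !scalerA.
  have -> : 2 * (1 - 2^-1) = 1 :> R by lra.
  by rewrite divff ?scale1r// pnatr_eq0.
rewrite (row_sum_delta x); apply: big_ind => // i _.
by apply: MZ; apply: MA.
Qed.

(** A symmetric body contains the midpoint of [x] and [- x], so [b >= 0] in any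
valid inequality [dot c x <= b]; and [b = 0] would make [c] vanish on the whole
body, so that the facet would have the dimension of the body.  Hence the
inequality can be scaled to [b = 1]. *)
Lemma facet_functional P F : centrally_symmetric P -> is_facet P F -> F !=set0 ->
  exists c, (forall x, P x -> dot c x <= 1) /\ F = P `&` [set x | dot c x = 1].
Proof.
move=> symP [d [dimP [c [b [max FE]]] dimF]] [y Fy].
have PN x : P x -> P (- x).
  by move=> xP; rewrite symP; exists x.
have b0 : 0 < b.
  rewrite lt_neqAle; apply/andP; split; last first.
    move: Fy; rewrite FE => -[yP /= yb].
    by have := max _ (PN _ yP); rewrite dotNr yb; lra.
  apply/eqP => bE; rewrite -{}bE in max FE.
  have PF : P = F.
    rewrite FE; apply/seteqP; split => [x xP|x []//]; split => //=.
    by apply/eqP; rewrite eq_le max//= -oppr_le0 -dotNr max//; exact: PN.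
  rewrite PF in dimP.
  exact: (n_Sn _ (esym (has_dim_uniq dimP dimF))).
exists (b^-1 *: c); split => [x xP|].
  by rewrite dotZl mulrC ler_pdivrMr// mul1r max.
rewrite FE; congr (_ `&` _); apply/seteqP; split => x /=; rewrite dotZl.
  by move=> ->; rewrite mulVf// gt_eqF.
by move=> /(congr1 ( *%R b)); rewrite mulVKf ?mulr1// gt_eqF.
Qed.

End Polytopes.

(** * The polytope of almost transversal sets *)

Section TransversalPolytope.
Context (R : realType) (n : nat) (C : eqType) (col : 'I_n -> C).
Implicit Types (S : {set 'I_n}) (c : 'rV[R]_n).

Definition flat_vec S : 'rV[R]_n :=
  \row_i ((i \in S)%:R / Num.sqrt #|S|%:R).

Definition generators : set 'rV[R]_n :=
  [set (-1) ^+ (p.1 : bool) *: flat_vec p.2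
     | p in [set p | almost_transversal col p.2]].

Definition transversal_polytope := conv_hull generators.

Lemma sqrt_card_gt0 S : almost_transversal col S -> 0 < Num.sqrt #|S|%:R :> R.
Proof.
move=> /exists_inP[x xS _]; rewrite sqrtr_gt0 ltr0n card_gt0.
by apply/finset.set0Pn; exists x.
Qed.

Lemma dot_flat_vec c S : dot c (flat_vec S) = mass (c 0) S / Num.sqrt #|S|%:R.
Proof.
rewrite /dot /mass mulr_suml [RHS]big_mkcond; apply: eq_bigr => i _.
by rewrite mxE; case: (i \in S); rewrite ?mul1r// mul0r mulr0.
Qed.

Lemma enorm_flat_vec S : almost_transversal col S -> enorm (flat_vec S) = 1.
Proof.
move=> FS; have s0 := sqrt_card_gt0 FS.
rewrite /enorm dot_flat_vec (_ : mass _ _ = Num.sqrt #|S|%:R) ?divff ?sqrtr1 ?gt_eqF//.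
rewrite /mass (eq_bigr (fun=> (Num.sqrt #|S|%:R)^-1)); last first.
  by move=> i iS; rewrite mxE iS mul1r.
rewrite sumr_const -[X in X = _]mulr_natl -[X in X / _](@sqr_sqrtr _ #|S|%:R) ?ler0n//.
by rewrite expr2 mulfK// gt_eqF.
Qed.

Lemma generator_sphere_orthants v : generators v ->
  unit_sphere v /\ (pos_orthant v \/ neg_orthant v).
Proof.
move=> [[b S] /= FS <-]; split.
  rewrite /unit_sphere /= /enorm dotZr dotC dotZr mulrA -expr2 sqrr_sign mul1r.
  exact: enorm_flat_vec.
have pos i : 0 <= flat_vec S 0 i.
  by rewrite mxE divr_ge0 ?ler0n ?sqrtr_ge0.
case: b => /=; [right|left] => i; rewrite mxE ?expr0 ?mul1r//.
by rewrite expr1 mulN1r oppr_le0.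
Qed.

Lemma generatorN v : generators v -> generators (- v).
Proof.
move=> [[b S] FS <-]; exists (~~ b, S) => //=.
by rewrite signrN scaleNr.
Qed.

Lemma flat_vec1 i : flat_vec [set i]%SET = delta_mx 0 i.
Proof.
by apply/rowP => j; rewrite !mxE cards1 sqrtr1 divr1 inE eqxx.
Qed.

Lemma generators_basis i : generators (delta_mx 0 i).
Proof.
exists (false, [set i]%SET) => /=; first exact: almost_transversal1.
by rewrite expr0 scale1r flat_vec1.
Qed.

Lemma transversal_polytope_symmetric : centrally_symmetric transversal_polytope.
Proof. by apply: conv_hull_symmetric; exact: generatorN. Qed.

Lemma transversal_polytope_dim : (0 < n)%N -> has_dim transversal_polytope n.
Proof.
move=> n0; apply: has_dim_full => // i; first exact: generators_basis.
by apply: generatorN; exact: generators_basis.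
Qed.

Lemma finite_generators : finite_set generators.
Proof. by apply: finite_image; exact: finite_finset. Qed.

Lemma sqrt_bounded_polar c (b : bool) :
  (forall x, transversal_polytope x -> dot c x <= 1) ->
  sqrt_bounded col (fun i => (-1) ^+ b * c 0 i).
Proof.
move=> max S FS.
have := max ((-1) ^+ b *: flat_vec S).
rewrite dotZr dot_flat_vec mulrA ler_pdivrMr ?sqrt_card_gt0// mul1r.
rewrite /mass -mulr_sumr; apply.
by apply: sub_conv_hull; exists (b, S).
Qed.

(** With the signs carried as booleans: a functional of value [+-1] at a signed
generator makes its set tight, and the two signs multiply. *)
Lemma mass_tight c (b b' : bool) S : almost_transversal col S ->
  dot c ((-1) ^+ b *: flat_vec S) = (-1) ^+ b' ->
  mass (c 0) S = (-1) ^+ (b (+) b') * Num.sqrt #|S|%:R.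
Proof.
move=> FS; have /gt_eqF s0 := sqrt_card_gt0 FS.
rewrite dotZr dot_flat_vec => /(congr1 ( *%R ((-1) ^+ b))).
rewrite signrMK -signr_addb => /(congr1 ( *%R^~ (Num.sqrt #|S|%:R))).
by rewrite mulfVK// s0.
Qed.

Lemma mass_signed c (b : bool) S :
  mass (fun i => (-1) ^+ b * c 0 i) S = (-1) ^+ b * mass (c 0) S.
Proof. by rewrite /mass mulr_sumr. Qed.

Lemma polar_not_same_sign c S S' (b b' : bool) :
  almost_transversal col S -> almost_transversal col S' ->
  (forall x, transversal_polytope x -> dot c x <= 1) ->
  S :&: S' = finset.set0 ->
  mass (c 0) S = (-1) ^+ b * Num.sqrt #|S|%:R ->
  mass (c 0) S' = (-1) ^+ b * Num.sqrt #|S'|%:R -> False.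
Proof.
move=> FS FS' max dis tS tS'.
apply: (tight_not_disjoint FS FS' (sqrt_bounded_polar b max) dis).
  by rewrite mass_signed tS signrMK.
by rewrite mass_signed tS' signrMK.
Qed.

Lemma polar_not_opposite_sign c S S' (b : bool) :
  almost_transversal col S -> almost_transversal col S' ->
  (forall x, transversal_polytope x -> dot c x <= 1) ->
  S :&: S' != finset.set0 ->
  mass (c 0) S = (-1) ^+ b * Num.sqrt #|S|%:R ->
  mass (c 0) S' = (-1) ^+ (~~ b) * Num.sqrt #|S'|%:R -> False.
Proof.
move=> FS FS' max meet tS tS'.
apply: (tight_not_opposite FS FS' (sqrt_bounded_polar b max) _ meet).
- have := sqrt_bounded_polar (~~ b) max.
  by under eq_fun do rewrite signrN mulNr.
- by rewrite mass_signed tS signrMK.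
- by rewrite mass_signed tS' signrN mulNr mulrN signrMK.
Qed.

(** A common point of both facets maximises the sum of their functionals, with
value 2, so some generator does too and then lies on both facets.  Its set and
the set of [a] carry equal signs for one functional and opposite signs for the
other. *)
Lemma facets_of_antipodes_disjoint a F F' :
  vertices transversal_polytope a ->
  is_facet transversal_polytope F -> is_facet transversal_polytope F' ->
  F a -> F' (- a) -> F `&` F' = set0.
Proof.
move=> /vertices_conv_hull[[s S] /= FS <-{a}] facF facF' Fa F'a.
have symP := transversal_polytope_symmetric.
have [c [maxc FE]] := facet_functional symP facF (ex_intro _ _ Fa).
have [c' [maxc' F'E]] := facet_functional symP facF' (ex_intro _ _ F'a).
rewrite -subset0 => y [].
move: Fa F'a; rewrite FE F'E => -[_ /= ca] [_ /= c'a] [yP /= cy] [_ /= c'y].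
have [x xP] : exists2 x, transversal_polytope x /\ generators x & dot (c + c') x = 2.
  have [x xG xE] : exists2 x, generators x & dot (c + c') x = 2.
    apply: (conv_hull_max_attained _ yP); last by rewrite dotDl cy c'y.
    by move=> z zP; rewrite dotDl lerD ?maxc ?maxc'.
  by exists x => //; split => //; exact: sub_conv_hull.
rewrite dotDl => cx2; case: xP => xP [[t S'] /= FS' xE].
have [cx c'x] : dot c x = 1 /\ dot c' x = 1.
  by have := maxc _ xP; have := maxc' _ xP; split; lra.
rewrite -{x xP cx2}xE in cx c'x.
have mS := mass_tight (b' := false) FS ca.
have mS' := mass_tight (b' := false) FS' cx.
have nS' := mass_tight (b' := false) FS' c'x.
have nS : mass (c' 0) S = (-1) ^+ (s (+) true) * Num.sqrt #|S|%:R.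
  by apply: mass_tight FS _; rewrite -[LHS]opprK -dotNr c'a.
rewrite !addbF !addbT in mS mS' nS nS'.
have [dis|meet] := eqVneq (S :&: S') finset.set0.
- have [st|/negPf st] := eqVneq s t.
    by rewrite -st in mS'; exact: polar_not_same_sign FS FS' maxc dis mS mS'.
  have {}st : t = ~~ s by case: (s) (t) st => -[].
  by rewrite -st in nS; exact: polar_not_same_sign FS FS' maxc' dis nS nS'.
- have [st|/negPf st] := eqVneq s t.
    by rewrite -st -[s]negbK in nS'; exact: polar_not_opposite_sign FS FS' maxc' meet nS nS'.
  have {}st : t = ~~ s by case: (s) (t) st => -[].
  by rewrite st in mS'; exact: polar_not_opposite_sign FS FS' maxc meet mS mS'.
Qed.


End TransversalPolytope.

Arguments generators R {n C} col.
Arguments transversal_polytope R {n C} col.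

(** * The number of vertices *)

Lemma card_vertices_transversal_polytope (R : realType) (n : nat) (C : eqType)
    (col : 'I_n -> C) :
  exists2 N, (N <= 2 * #|[set S | almost_transversal col S]%SET|)%N &
    (vertices (transversal_polytope R col) #= `I_N)%card.
Proof.
have sub := @vertices_conv_hull R n (generators R col).
have /finite_setP[N VN] := sub_finite_set sub (finite_generators R col).
exists N => //.
set D := finset.setX [set: bool]%SET [set S | almost_transversal col S]%SET.
have -> : (2 * #|[set S | almost_transversal col S]%SET|)%N = #|D|.
  by rewrite cardsX cardsT card_bool.
rewrite -card_le_II -(card_le_eql VN).
apply: card_le_trans (subset_card_le sub) _.
pose g (i : 'I_#|D|) := let p := enum_val i in (-1) ^+ (p.1 : bool) *: flat_vec R p.2.
have gen : generators R col `<=` range g.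
  move=> _ [p /= Fp <-].
  have pD : p \in D by rewrite !inE.
  by exists (enum_rank_in pD p) => //; rewrite /g enum_rankK_in.
apply: card_le_trans (subset_card_le gen) _.
rewrite (card_le_eqr card_II).
exact: card_image_le.
Qed.

Section Estimate.
Context (R : realType).

(** With [k <= sqrt n + 1], the logarithm of the vertex count exceeds
[sqrt n * ln n / 2] by at most [ln n + 15 sqrt n]; this is that excess divided by
[sqrt n * ln n], the constant 15 being a crude one. *)
Definition vertex_error (n : nat) : R := (Num.sqrt n%:R)^-1 + 15 * (ln n%:R)^-1.

Lemma vertex_error_cvg0 : vertex_error n @[n --> \oo] --> (0 : R).
Proof.
have large (M : R) : \forall n \near \oo, M <= n%:R.
  by apply: cvgry_ge; exact: cvgr_idn.
have sqrt_oo : Num.sqrt (n%:R : R) @[n --> \oo] --> +oo.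
  apply/cvgryPge => M; near=> n.
  rewrite (le_trans (ler_norm M))// -sqrtr_sqr ler_wsqrtr//.
  by near: n; exact: large.
have ln_oo : ln (n%:R : R) @[n --> \oo] --> +oo.
  apply/cvgryPge => M; near=> n.
  have n_ge : expR M <= n%:R by near: n; exact: large.
  by rewrite -ler_expR lnK// posrE (lt_le_trans _ n_ge)// expR_gt0.
rewrite -[0]addr0 -[X in _ + X](mulr0 15).
apply: cvgD; last (apply: cvgM; first exact: cvg_cst).
  apply/gtr0_cvgV0 => //; near=> n.
  by rewrite sqrtr_gt0; near: n; exact: (cvgry_gt cvgr_idn).
apply/gtr0_cvgV0 => //; near=> n.
by near: n; exact: (cvgry_gt ln_oo).
Unshelve. all: by end_near. Qed.

Lemma vertex_count_lt (n k : nat) : (2 <= n)%N -> (0 < k)%N ->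
  k%:R <= Num.sqrt n%:R + 1 :> R ->
  (2 * (k * 2 ^ k * k.+1 ^ k))%:R <
    expR ((2^-1 + vertex_error n) * Num.sqrt n%:R * ln n%:R) :> R.
Proof.
move=> n2 k0; set s := Num.sqrt _; set L := ln _ => ks.
have L0 : 0 < L by rewrite ln_gt0// ltr1n.
have s1 : 1 <= s by rewrite -sqrtr1 ler_wsqrtr// ler1n ltnW.
have s0 : 0 < s by lra.
have nE : n%:R = s ^+ 2 by rewrite sqr_sqrtr.
have LE : L = 2 * ln s by rewrite /L nE lnXn// mulr_natl.
have k0R : 0 < k%:R :> R by rewrite ltr0n.
(* As s >= 1, k + 1 <= s + 2 <= 3 * s. *)
have lnk1 : ln k.+1%:R < 3 + L / 2.
  apply: (@le_lt_trans _ _ (ln (3 * s))).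
    by rewrite ler_ln ?posrE ?ltr0n ?mulr_gt0// -natr1; lra.
  by rewrite lnM ?posrE//; have : ln 3 < 3 :> R by [exact: ln_sublinear]; lra.
have lnk : ln k%:R < 3 + L / 2.
  by apply: le_lt_trans lnk1; rewrite ler_ln ?posrE ?ltr0n// ler_nat.
have ln2 : ln 2 < 2 :> R by exact: ln_sublinear.
have ln2_0 : 0 < ln 2 :> R by rewrite ln_gt0// ltr1n.
rewrite -[ltLHS]lnK ?posrE ?ltr0n ?muln_gt0 ?expn_gt0 ?k0// ltr_expR.
rewrite !natrM !natrX !lnM ?posrE ?mulr_gt0 ?exprn_gt0 ?ltr0n//.
rewrite !lnXn ?ltr0n// -[ln 2 *+ k]mulr_natl -[ln k.+1%:R *+ k]mulr_natl.
have -> : (2^-1 + vertex_error n) * s * L = s * L / 2 + L + 15 * s.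
  rewrite /vertex_error -/s -/L; field.
  by rewrite !gt_eqF.
have b1 : k%:R * ln 2 <= (s + 1) * 2 by apply: ler_pM; lra.
have b2 : k%:R * ln k.+1%:R <= (s + 1) * (3 + L / 2).
  by apply: ler_pM => //; rewrite ?ln_ge0 ?ler1n//; lra.
nra.
Qed.

End Estimate.

(** * The theorem *)

Theorem theorem2p1 (R : realType) :
  exists eps : nat -> R,
    (eps n @[n --> \oo] --> (0 : R)) /\
    forall n : nat, (0 < n)%N ->
    exists P : set 'rV[R]_n,
      [/\ is_polytope P, has_dim P n & centrally_symmetric P] /\
      [/\ (forall v, vertices P v ->
             unit_sphere v /\ (pos_orthant v \/ neg_orthant v)),
          (forall (a : 'rV[R]_n) (F F' : set 'rV[R]_n), vertices P a ->
             is_facet P F -> is_facet P F' -> F a -> F' (- a) ->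
             F `&` F' = set0)
        & ((2 <= n)%N ->
           exists m : nat, (vertices P #= `I_m)%card /\
             (m%:R < expR ((2^-1 + eps n) * Num.sqrt (n%:R) * ln (n%:R)) :> R))].
Proof.
exists (@vertex_error R); split; first exact: vertex_error_cvg0.
move=> n n0.
pose k := (Num.truncn (Num.sqrt n%:R : R)).+1.
have /andP[ks sk] := truncn_itv (sqrtr_ge0 (n%:R : R)).
have nk : (n <= k * k)%N.
  rewrite -(ler_nat R) natrM -[leLHS]sqr_sqrtr ?ler0n// expr2.
  by apply: ler_pM; rewrite ?sqrtr_ge0 ?ltW.
pose col (i : 'I_n) : 'I_k := inord (i %/ k).
pose row (i : 'I_n) : 'I_k := inord (i %% k).
have grid_inj i j : col i = col j -> row i = row j -> i = j.
  move=> /(congr1 val) + /(congr1 val); rewrite /= !inordK ?ltn_mod//; last 2 first.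
  - by rewrite ltn_divLR// (leq_trans (ltn_ord j)).
  - by rewrite ltn_divLR// (leq_trans (ltn_ord i)).
  by move=> dij mij; apply: val_inj; rewrite /= (divn_eq i k) (divn_eq j k) dij mij.
exists (transversal_polytope R col); split; split.
- by exists (generators R col); split => //; exact: finite_generators.
- exact: transversal_polytope_dim.
- exact: transversal_polytope_symmetric.
- by move=> v /vertices_conv_hull; exact: generator_sphere_orthants.
- exact: facets_of_antipodes_disjoint.
- move=> n2; have [N Nle VN] := card_vertices_transversal_polytope R col.
  have kn : k%:R <= Num.sqrt n%:R + 1 :> R by rewrite -natr1 lerD2r.
  exists N; split => //; apply: le_lt_trans (vertex_count_lt n2 (ltn0Sn _) kn).
  rewrite ler_nat; apply: leq_trans Nle _; rewrite leq_mul2l/=.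
  by have := card_almost_transversal grid_inj; rewrite !card_ord.
Qed.
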